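(* Suppose that $\bar K\ge2$ and $\eta>0$ satisfy $$\frac{2\bar K-3}{2(\bar K-1)}+\log\left(\frac{\bar K}{2}\right)>\frac{2}{\eta},$$ and that the integer $n\ge2$ satisfies $$n\ge\frac{4}{\left(\frac{2\bar K-3}{2(\bar K-1)}+\log\left(\frac{\bar K}{2}\right)\right)\eta-2},\qquad\frac{n}{\log(n)}\ge\eta\bar K.$$ Then for any integer $p\in\left[\eta\log(n),\frac{n}{\bar K}\right]$ with $p\ge3$, we have $$\frac{n(p-2)}{(n^2-3)(n!)^2}\ge\frac{1}{\binom{n^2}{np}(n^2-np+1)}.$$
   Context: $\log$ is the natural logarithm; $\bar K$ and $\eta$ are real numbers. (In the paper, $n$ is the size of the optimal transport problem and $p$ is a band width, both positive integers.) *)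

(* Defs.v *)
From mathcomp Require Import all_boot all_order all_algebra.

(* Main.v *)
(** Write [k = n p] and [y = n / p >= K >= 2], and let [A] be the left-hand side
    of the hypothesis on [K] and [eta].  Counting falling factorials and using
    [k! <= e k (k / e)^k], one gets ['C(n^2, k) >= (e (y - 1))^k / (e k)].
    Since [y - 1 >= y / 2 >= K / 2], this is at least [exp (k A) / (e k)], and
    the lower bounds on [p] and [n] give [k A >= (2 n + 4) ln n].  Hence
    ['C(n^2, k) >= n^(2 n + 1)], whereas [n!^2 <= n^(2 n)]. *)
Require Import Defs.
From mathcomp Require Import all_boot all_order all_algebra.
From mathcomp Require Import all_classical all_reals all_analysis.
From mathcomp Require Import ring lra.
Import Order.TTheory GRing.Theory Num.Theory.
Local Open Scope ring_scope.

(** Each of the factors [m], ..., [m - k + 1] is at least [m - k]; truncated subtraction covers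
    [m < k]. *)
Lemma expn_le_ffact (m k : nat) : ((m - k) ^ k <= m ^_ k)%N.
Proof.
elim: k => // k IHk; rewrite ffactnSr expnSr leq_mul //.
- by apply: leq_trans IHk; case: (k) => // j; rewrite leq_exp2r ?leq_sub2l.
- by rewrite leq_sub2l.
Qed.

Lemma fact_le_expn (n : nat) : (n`! <= n ^ n)%N.
Proof.
elim: n => // n IHn; rewrite factS expnS leq_mul2l /=.
by apply: leq_trans IHn _; case: n => // n; rewrite leq_exp2r.
Qed.

(** Raise [1 - 1/(m+1) <= exp (-1/(m+1))] to the power [m+1]. *)
Lemma expR1_mul_expn_le (R : realType) (m : nat) :
  expR 1 * m%:R ^+ m.+1 <= m.+1%:R ^+ m.+1 :> R.
Proof.
have m1_gt0 : 0 < m.+1%:R :> R by rewrite ltr0n.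
have /(lerXn2r m.+1) : m%:R / m.+1%:R <= expR (- m.+1%:R^-1) :> R.
  suff -> : m%:R / m.+1%:R = 1 - m.+1%:R^-1 :> R by apply: expR_ge1Dx.
  by rewrite -[m.+1%:R]natr1; field; rewrite natr1 gt_eqF.
rewrite !nnegrE divr_ge0 // expR_ge0 => /(_ isT isT).
rewrite -expRM_natr mulNr mulVf ?gt_eqF // expRN expr_div_n.
by rewrite ler_pdivrMr ?exprn_gt0 // mulrC ler_pdivlMr ?expR_gt0 // mulrC.
Qed.

(** This is [j! <= e j (j/e)^j] at [j = k+1], cleared of denominators. The induction step costs a
    factor [e], which [expR1_mul_expn_le] absorbs. *)
Lemma factM_expR_le (R : realType) (k : nat) :
  k.+1`!%:R * expR k%:R <= k.+1%:R ^+ k.+2 :> R.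
Proof.
elim: k => [|k IHk]; first by rewrite expR0 mulr1 expr1n.
rewrite factS natrM -[in expR _]natr1 expRD exprS -!mulrA ler_wpM2l //.
apply: le_trans (expR1_mul_expn_le R k.+1).
by rewrite mulrA mulrC ler_wpM2l ?expR_ge0.
Qed.

(** From [exp (-1/2) >= 1/2] one gets [exp (1/2) <= 2]; then square. *)
Lemma expR1_le4 (R : realType) : expR 1 <= 4 :> R.
Proof.
have : 1 - 2^-1 <= expR (- 2^-1) :> R by apply: expR_ge1Dx.
rewrite expRN -[_^-1 in leRHS]mul1r ler_pdivlMr ?expR_gt0 // => h.
have -> : expR 1 = expR 2^-1 ^+ 2 :> R by rewrite -expRM_natr mulVf.
by have := expR_ge0 (2^-1 : R); nra.
Qed.

Lemma binomial_ge (R : realType) (m k : nat) : (0 < k <= m)%N ->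
  (expR 1 * (m%:R / k%:R - 1)) ^+ k <= 'C(m, k)%:R * (expR 1 * k%:R) :> R.
Proof.
case: k => // k /= lekm; have k_gt0 : 0 < k.+1%:R :> R by rewrite ltr0n.
have kk_gt0 := exprn_gt0 k.+1 k_gt0.
(* Multiplying by [k^k] turns the base on the left into [e (m - k)]. *)
rewrite -(ler_pM2r kk_gt0) -exprMn.
have -> : expR 1 * (m%:R / k.+1%:R - 1) * k.+1%:R = expR 1 * (m - k.+1)%:R :> R.
  by rewrite natrB // -mulrA mulrBl divfK ?gt_eqF // mul1r.
rewrite exprMn -!mulrA -exprS.
apply: (@le_trans _ _ (expR 1 ^+ k.+1 * ('C(m, k.+1) * k.+1`!)%:R)).
  by rewrite ler_wpM2l ?exprn_ge0 ?expR_ge0 // -natrX ler_nat bin_ffact expn_le_ffact.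
rewrite natrM mulrCA ler_wpM2l // exprS -mulrA ler_wpM2l ?expR_ge0 //.
by rewrite -expRM_natr mul1r mulrC factM_expR_le.
Qed.

Theorem lemma3 (R : realType) (K eta : R) (n : nat)
    (hK : 2 <= K) (heta : 0 < eta)
    (hKeta : (2 * K - 3) / (2 * (K - 1)) + ln (K / 2) > 2 / eta)
    (hn : (2 <= n)%N)
    (hn1 : n%:R >=
       4 / (((2 * K - 3) / (2 * (K - 1)) + ln (K / 2)) * eta - 2))
    (hn2 : n%:R / ln (n%:R : R) >= eta * K)
    (p : nat) (hp3 : (3 <= p)%N)
    (hp_lo : eta * ln (n%:R : R) <= p%:R)
    (hp_hi : p%:R <= n%:R / K) :
  (n%:R * (p%:R - 2)) / ((n%:R ^+ 2 - 3) * (n`!)%:R ^+ 2) >=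
  1 / ('C(n ^ 2, n * p)%:R * (n%:R ^+ 2 - n%:R * p%:R + 1)) :> R.
Proof.
set A := _ / _ + ln _ in hKeta hn1.
have K_gt0 : 0 < K by lra.
have p_ge3 : 3 <= p%:R :> R by rewrite (ler_nat _ 3).
have p_gt0 : 0 < p%:R :> R by lra.
have hpK : p%:R * K <= n%:R by rewrite -ler_pdivlMr.
(* [n >= p K >= 3 * 2]. *)
have n_ge6 : 6 <= n%:R :> R by nra.
have n_gt0 : 0 < n%:R :> R by lra.
have ln_n : 0 <= ln n%:R :> R by rewrite ln_ge0 //; lra.
have A_gt : 2 < A * eta by rewrite -ltr_pdivrMr.
have hnA : 2 * n%:R + 4 <= n%:R * (A * eta).
  by move: hn1; rewrite ler_pdivrMr ?subr_gt0 //; lra.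
have A_gt0 : 0 < A by apply: lt_trans hKeta; rewrite divr_gt0.
pose y : R := n%:R / p%:R.
have y_geK : K <= y by rewrite ler_pdivlMr // mulrC.
(* The fraction in [A] is at most 1, and [K / 2 <= K - 1 <= y - 1] since [K >= 2]. *)
have A_le : A <= 1 + ln (y - 1).
  apply: lerD; first by rewrite ler_pdivrMr; lra.
  by rewrite ler_ln ?posrE; lra.
have k_gt0 : (0 < n * p)%N by rewrite muln_gt0 -!(ltr0n R) n_gt0.
have lepn : (p <= n)%N by rewrite -(ler_nat R); nra.
have lek : (n * p <= n ^ 2)%N by rewrite -mulnn leq_mul2l lepn orbT.
have C_gt0 : 0 < 'C(n ^ 2, n * p)%:R :> R by rewrite ltr0n bin_gt0.
(* Of the exponent, [2 n] will dominate [n!^2], 3 will pay for the factor [e n p], and 1 remains to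
   spare. *)
have pow_le : n%:R ^+ (2 * n + 4) <= (expR 1 * (y - 1)) ^+ (n * p) :> R.
  have e_y : expR (1 + ln (y - 1)) = expR 1 * (y - 1).
    by rewrite expRD lnK // posrE; lra.
  rewrite -e_y -[X in X ^+ _ <= _](@lnK R) ?posrE //.
  rewrite -!expRM_natr ler_expR.
  apply: (@le_trans _ _ (A * (n * p)%:R)); last by rewrite ler_wpM2r.
  rewrite natrD !natrM.
  have : ln n%:R * (2 * n%:R + 4) <= ln n%:R * (n%:R * (A * eta)) :> R.
    by rewrite ler_wpM2l.
  move/le_trans; apply.
  have -> : ln n%:R * (n%:R * (A * eta)) = A * (n%:R * (eta * ln n%:R)) :> R.
    by ring.
  by rewrite (ler_wpM2l (ltW A_gt0)) // (ler_wpM2l (ltW n_gt0)).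
have C_ge : n%:R ^+ (2 * n) * n%:R <= 'C(n ^ 2, n * p)%:R :> R.
  have n3_gt0 : 0 < n%:R ^+ 3 :> R by rewrite exprn_gt0.
  rewrite -(ler_pM2r n3_gt0) -mulrA -exprS -exprD.
  apply: (le_trans pow_le).
  have -> : y = (n ^ 2)%:R / (n * p)%:R.
    by rewrite /y natrX natrM; field; rewrite !gt_eqF.
  apply: (le_trans (@binomial_ge R (n ^ 2) (n * p) _)); first by rewrite k_gt0.
  (* [e <= 4 <= n] and [n p <= n^2] give [e n p <= n^3]. *)
  rewrite (ler_wpM2l (ltW C_gt0)) // exprS ler_pM ?expR_ge0 //.
    by apply: le_trans (expR1_le4 R) _; lra.
  by rewrite -natrX ler_nat.
have fact_gt : 0 < n`!%:R :> R by rewrite ltr0n fact_gt0.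
have fact_le : n`!%:R ^+ 2 <= n%:R ^+ (2 * n) :> R.
  by rewrite mulnC exprM lerXn2r ?nnegrE // -?natrX ?ler_nat ?fact_le_expn.
have fact2_gt : 0 < n`!%:R ^+ 2 :> R by rewrite exprn_gt0.
have np_le : p%:R <= n%:R :> R by rewrite ler_nat.
have D_ge1 : 1 <= n%:R ^+ 2 - n%:R * p%:R + 1 :> R.
  by rewrite expr2 -mulrBr lerDr mulr_ge0 // subr_ge0.
have n2_gt3 : 0 < n%:R ^+ 2 - 3 :> R by nra.
have D_gt0 := lt_le_trans ltr01 D_ge1.
rewrite ler_pdivrMr ?mulr_gt0 // mulrAC ler_pdivlMr ?mulr_gt0 // mul1r.
(* After cross-multiplication, [(n^2 - 3) n!^2] is bounded by [n^2 n^(2 n)], that is, [n] times the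
   lower bound in [C_ge]. *)
apply: (@le_trans _ _ (n%:R ^+ 2 * n%:R ^+ (2 * n))).
  by rewrite ler_pM ?(ltW n2_gt3) ?(ltW fact2_gt) //; lra.
have -> : n%:R ^+ 2 * n%:R ^+ (2 * n) = n%:R * (n%:R ^+ (2 * n) * n%:R) :> R.
  by rewrite expr2; ring.
rewrite -mulrA (ler_wpM2l (ltW n_gt0)) //.
apply: (le_trans C_ge).
(* The remaining factors [p - 2] and [n^2 - n p + 1] are both at least 1. *)
rewrite mulrCA (ler_peMr (ltW C_gt0)) // -[1]mulr1 ler_pM //; lra.
Qed.
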